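(* Let $G=(V,E)$ be a finite, simple, nonempty, connected graph. In the all-path convexity, $$i(G)=\begin{cases}1, & \text{if } G \text{ is trivial (one vertex)},\\ 2, & \text{if } |V|=2 \text{ or } G \text{ is 2-connected},\\ eb(G), & \text{otherwise}.\end{cases}$$
   Context: The all-path interval is $I(S)=S\cup\{v\in V\mid v$ lies on some path of $G$ whose two endpoints are distinct vertices of $S\}$. $S$ is an interval set if $I(S)=V$, and the interval number $i(G)$ is the minimum size of an interval set. A block of $G$ is a cut edge or a maximal 2-connected subgraph; an end block is a block corresponding to a leaf of the block-cut tree (the tree with a node per block and per cut vertex, a block adjacent to the cut vertices it contains). $eb(G)$ is the number of end blocks of $G$. *)

(* Defs.v *)
From mathcomp Require Import all_boot.

Set Implicit Arguments.
Unset Strict Implicit.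
Unset Printing Implicit Defensive.

(* A finite simple graph is a symmetric irreflexive relation [e] on [T : finType];
   a subgraph of it is given by a vertex set and a set of unordered edges. *)
Definition subgraph (T : finType) : Type := ({set T} * {set {set T}})%type.

Section AllPath.
Variables (T : finType) (e : rel T).
Implicit Types (A S : {set T}) (r : rel T) (x y v : T) (H K : subgraph T).

(* The vertex sequence [x :: p] of a path has no repetition, so [size p < #|T|]
   and the bounded quantification loses nothing: see [on_pathP]. *)
Definition on_path x y v : bool :=
  [exists n : 'I_#|T|, exists p : n.-tuple T,
     [&& path e x p, last x p == y, uniq (x :: p) & v \in x :: p]].

Definition interval S : {set T} :=
  S :|: [set v | [exists x in S, exists y in S, (x != y) && on_path x y v]].

Definition interval_set S : bool := interval S == [set: T].

Definition interval_number : nat :=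
  #|[arg min_(S < [set: T] | interval_set S) #|S| ]|.

Definition connected_on A r : bool :=
  [forall x in A, forall y in A,
     connect [rel u v | [&& u \in A, v \in A & r u v]] x y].

Definition two_connected_on A r : bool :=
  [&& 2 < #|A|, connected_on A r & [forall v in A, connected_on (A :\ v) r]].

(* [cut_vertex] and [cut_edge] are meant for a connected graph [e], where
   increasing the number of components means disconnecting. *)
Definition cut_vertex v : bool := ~~ connected_on [set~ v] e.

Definition cut_edge x y : bool :=
  e x y &&
  ~~ connected_on [set: T] [rel u v | e u v && ([set u; v] != [set x; y])].

Definition is_subgraph H : bool :=
  [forall a in H.2, [exists x in H.1, exists y in H.1,
     e x y && (a == [set x; y])]].

Definition subgraph_le H K : bool := (H.1 \subset K.1) && (H.2 \subset K.2).

Definition two_connected_subgraph H : bool :=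
  is_subgraph H && two_connected_on H.1 [rel x y | [set x; y] \in H.2].

Definition maximal_two_connected H : bool :=
  two_connected_subgraph H &&
  [forall K : subgraph T,
     (two_connected_subgraph K && subgraph_le H K) ==> (K == H)].

Definition edge_subgraph x y : subgraph T := ([set x; y], [set [set x; y]]).

Definition block H : bool :=
  [exists x, exists y, cut_edge x y && (H == edge_subgraph x y)]
  || maximal_two_connected H.

(* The block-cut tree: [inl H] stands for a block, [inr v] for a cut vertex. *)
Definition bct_node (n : subgraph T + T) : bool :=
  match n with inl H => block H | inr v => cut_vertex v end.

Definition bct_adj (n m : subgraph T + T) : bool :=
  match n, m with
  | inl H, inr v | inr v, inl H => v \in H.1
  | _, _ => false
  end.

Definition bct_leaf (n : subgraph T + T) : bool :=
  bct_node n && (#|[set m : subgraph T + T | bct_node m && bct_adj n m]| == 1).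

Definition eb : nat := #|[set H : subgraph T | bct_leaf (inl H)]|.

Lemma on_pathP x y v :
  reflect (exists p : seq T,
             [/\ path e x p, last x p = y, uniq (x :: p) & v \in x :: p])
          (on_path x y v).
Proof.
apply: (iffP existsP) => [[n /existsP[p /and4P[xp /eqP py up vp]]]|].
  by exists p.
case=> p [xp py up vp].
have ltp : size p < #|T| by have := max_card (mem (x :: p)); rewrite (card_uniqP up).
exists (Ordinal ltp); apply/existsP; exists (in_tuple p).
by apply/and4P; split => //; apply/eqP.
Qed.

Lemma interval_setT : interval_set [set: T].
Proof. by rewrite /interval_set /interval setTU. Qed.

Lemma interval_numberP :
  (exists2 S, interval_set S & #|S| = interval_number)
  /\ (forall S, interval_set S -> interval_number <= #|S|).
Proof.
rewrite /interval_number; case: arg_minnP; first exact: interval_setT.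
by move=> S HS minS; split; first by exists S.
Qed.

End AllPath.

(* Main.v *)
Require Import Defs.
From mathcomp Require Import all_boot.

(* Suppose [G] has a cut vertex.  Call a component of [G - c], for a cut vertex
   [c], a lobe if it contains no cut vertex of [G].  Distinct lobes are
     disjoint,
   and a path that enters and leaves a lobe uses [c] twice, so an interval set
   meets every lobe.  Conversely let [S] have one vertex in each lobe.  Every
   component of [G - w], for a cut vertex [w], contains a lobe, so no vertex [w]
   separates a vertex [v <> w] from [S]; the fan lemma then provides two paths
   from [v] to [S] which share only [v], i.e. [v] is in [I(S)].  The same lemma
   settles the 2-connected case.  Finally the end blocks are exactly the
   subgraphs induced by a lobe together with its cut vertex. *)

Set Implicit Arguments.
Unset Strict Implicit.
Unset Printing Implicit Defensive.

(** * Connectivity inside a vertex set *)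

Section Restriction.
Variable T : finType.
Implicit Types (A B C S : {set T}) (r : rel T) (x y v w : T).

Definition restr A r : rel T := [rel u v | [&& u \in A, v \in A & r u v]].

Lemma restr_sym A r : symmetric r -> symmetric (restr A r).
Proof. by move=> rS u v; apply/and3P/and3P => -[? ? ?]; split;
  rewrite // rS. Qed.

Lemma connected_onP A r :
  reflect {in A &, forall x y, connect (restr A r) x y} (connected_on A r).
Proof.
apply: (iffP forall_inP) => [cA x y xA yA|cA x xA].
  exact: (forall_inP (cA x xA)).
by apply/forall_inP => y; apply: cA.
Qed.

Lemma closed_connect r A x y :
  (forall u v, u \in A -> r u v -> v \in A) ->
  connect r x y -> x \in A -> y \in A.
Proof.
move=> clA /connectP[p]; elim: p x => [|z p IH] x /=; first by move=> _ ->.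
by case/andP=> xz zp yE xA; apply: IH zp yE (clA _ _ xA xz).
Qed.

Lemma connect_restr_closed r A x y :
  (forall u v, u \in A -> r u v -> v \in A) ->
  x \in A -> connect r x y -> connect (restr A r) x y.
Proof.
move=> clA + /connectP[p]; elim: p x => [|z p IH] x /= xA; first by move=> _ ->.
case/andP=> xz zp yE; have zA := clA _ _ xA xz.
by apply: connect_trans (IH z zA zp yE); apply: connect1;
  rewrite /restr /= xA zA.
Qed.

Lemma connect_restrS A B r r' x y :
  A \subset B -> {in A &, subrel r r'} ->
  connect (restr A r) x y -> connect (restr B r') x y.
Proof.
move=> /subsetP sAB srr; apply: connect_sub => u v /= /and3P[uA vA uv].
by apply: connect1; rewrite /restr /= !sAB //= srr.
Qed.

Lemma connect_restr_path A r x p :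
  path r x p -> {subset x :: p <= A} -> connect (restr A r) x (last x p).
Proof.
elim: p x => [|y p IH] x //= /andP[xy yp] sA.
have sA' : {subset y :: p <= A} by move=> z zp; apply: sA; rewrite inE zp orbT.
apply: connect_trans (IH y yp sA'); apply: connect1.
by rewrite /restr /= xy sA ?mem_head // sA' ?mem_head.
Qed.

Lemma connect_restr_mem A r x y :
  connect (restr A r) x y -> x \in A -> y \in A.
Proof. by apply: closed_connect => u v _ /and3P[]. Qed.

Lemma connect_restrP A r x y :
  x \in A -> connect (restr A r) x y ->
  exists p, [/\ path r x p, last x p = y, uniq (x :: p) & {subset x :: p <= A}].
Proof.
move=> xA /connectP[p0 p0P ->]; case: (shortenP p0P) => p xp up _.
exists p; split=> //; first by apply: sub_path xp => u v /and3P[].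
elim: p x xA {p0 p0P up} xp => [|z p IH] x xA /=.
  by move=> _ w; rewrite inE => /eqP->.
case/andP=> /and3P[_ zA _] zp w; rewrite inE => /predU1P[->//|].
exact: IH.
Qed.

End Restriction.

Section Graph.
Variables (T : finType) (e : rel T).
Hypotheses (e_sym : symmetric e) (e_irr : irreflexive e).
Implicit Types (A B C D S : {set T}) (x y u v w c z : T) (p q : seq T).

(** * Fans and the all-path interval *)

Let I := interval e.

(** The paths may be empty: with both empty this says that [v] is in [S], so the vertices of [S]
    have a fan too. *)
Definition fan S v p1 p2 :=
  [&& path e v p1, path e v p2, last v p1 \in S, last v p2 \in S
    & uniq (v :: p1 ++ p2)].

Lemma fanC S v p1 p2 : fan S v p1 p2 = fan S v p2 p1.
Proof.
rewrite /fan /= !mem_cat uniq_catC orbC.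
by apply/and5P/and5P => -[? ? ? ? ?]; split.
Qed.

Lemma interval_fan S v : v \in I S -> exists p1 p2, fan S v p1 p2.
Proof.
rewrite !inE => /orP[vS|]; first by exists [::], [::]; rewrite /fan /= vS.
case/exists_inP=> x xS /exists_inP[y yS /andP[_ /on_pathP[p [xp py up vp]]]].
case/splitPl: vp xp py up => p1 p2 p1v; rewrite cat_path last_cat p1v.
case/andP=> xp1 vp2 p2y up; exists (rev (belast x p1)), p2.
have pr : path e v (rev (belast x p1)).
  by have := rev_path e x p1; rewrite p1v => ->; rewrite (eq_path (e' := e)).
have pl : last v (rev (belast x p1)) = x.
  by rewrite -p1v; case: (p1) => [|a l] /=; rewrite ?rev_cons ?last_rcons.
apply/and5P; split; rewrite ?pl ?p2y //.
have -> : v :: rev (belast x p1) ++ p2 = rev (x :: p1) ++ p2.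
  by rewrite (lastI x) p1v rev_rcons.
by rewrite -(perm_uniq (s1 := (x :: p1) ++ p2)) // perm_cat2r perm_sym perm_rev.
Qed.

(** The reversed first path followed by the second is one path between two vertices of [S], so all
    its vertices lie in [I S], not only [v]. *)
Lemma fan_interval S v p1 p2 : fan S v p1 p2 -> {subset v :: p1 ++ p2 <= I S}.
Proof.
case/and5P=> vp1 vp2 p1S p2S up z.
have [p1E|p1N] := eqVneq (last v p1) (last v p2).
  (* Paths that share only [v] have the same end only if both are empty. *)
  have [p1_0 p2_0] : p1 = [::] /\ p2 = [::].
    case/lastP: p1 vp1 p1S up p1E => [|p1 a] vp1 p1S up p1E;
      case/lastP: p2 vp2 p2S up p1E => [|p2 b] vp2 p2S up //=.
    - by rewrite last_rcons => vb; move: up; rewrite /= mem_rcons vb mem_head.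
    - by rewrite last_rcons => av; move: up;
      rewrite /= cats0 mem_rcons -av mem_head.
    - rewrite !last_rcons => ab; move: up;
      rewrite /= cat_uniq => /and4P[_ _ /hasP[]].
      by exists b; rewrite mem_rcons ?ab mem_head.
  by rewrite p1_0 p2_0 /= inE => /eqP->; rewrite p1_0 /= in p1S;
    rewrite inE p1S.
move=> zp; rewrite !inE; apply/orP; right; apply/exists_inP;
  exists (last v p1) => //.
apply/exists_inP; exists (last v p2) => //; rewrite p1N /=; apply/on_pathP.
have rE : rev (v :: p1) = last v p1 :: rev (belast v p1) by rewrite lastI
  rev_rcons.
exists (rev (belast v p1) ++ p2).
have rl : last (last v p1) (rev (belast v p1)) = v.
  by case: (p1) => [|a l] //=; rewrite rev_cons last_rcons.
have pE : perm_eq (v :: p1 ++ p2) (last v p1 :: rev (belast v p1) ++ p2).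
  by rewrite -!cat_cons -rE perm_cat2r perm_sym perm_rev.
split; rewrite -?(perm_uniq pE) -?(perm_mem pE) //; last by rewrite last_cat rl.
by rewrite cat_path rl rev_path (eq_path (e' := e)) ?vp1.
Qed.

Lemma sub_interval S : S \subset I S.
Proof. exact: subsetUl. Qed.

Lemma first_hit A x p :
  path e x p -> has (mem A) (x :: p) ->
  exists q, [/\ path e x q, last x q \in A, {subset x :: q <= x :: p},
                uniq (x :: p) -> uniq (x :: q) & all (predC (mem A)) (belast x
                  q)].
Proof.
elim: p x => [|y p IH] x /=.
  by rewrite orbF => _ xA; exists [::]; split.
case/andP=> xy yp; have [xA _|xA] := boolP (x \in A).
  by exists [::]; split=> // z; rewrite !inE => /eqP->; rewrite eqxx.
rewrite /= => hp; have [q [yq qA sq uq aq]] := IH y yp hp.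
exists (y :: q); split=> //=; rewrite ?xy ?xA //.
  by move=> z; rewrite [_ \in x :: y :: q]in_cons [_ \in x :: _]in_cons =>
    /orP[->//|/sq->]; rewrite orbT.
by case/andP=> xN /uq /= ->; rewrite andbT; apply: contra xN => /sq.
Qed.

(** From [z'], follow a path of its fan that avoids [z] up to the first vertex on the fan of [z].
    From there it takes over the path it has hit, since [z] can use the other one. *)
Lemma interval_disjoint_paths S z z' :
  z \in I S -> z' \in I S -> z != z' ->
  exists p p', [/\ path e z p && path e z' p', last z p \in S, last z' p' \in S,
    uniq ((z :: p) ++ z' :: p') & {subset (z :: p) ++ z' :: p' <= I S}].
Proof.
move=> /interval_fan[a1 [a2 fa]] /interval_fan[b1 [b2 fb]] zz'.
(* The two paths of the fan at [z'] share only [z'], so one of them misses [z]. *)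
have [b [z'b bS ub zb bI]] : exists b, [/\ path e z' b, last z' b \in S,
    uniq (z' :: b), z \notin b & {subset z' :: b <= I S}].
  have fI := fan_interval fb; have /and5P[pb1 pb2 b1S b2S] := fb.
  rewrite /= mem_cat cat_uniq negb_or -andbA => /and5P[zb1 zb2 ub1 /hasPn hb
    ub2].
  have [zb|zb] := boolP (z \in b1); last first.
    exists b1; split; rewrite //= ?zb1 //.
    by move=> y yb; apply: fI; rewrite -cat_cons mem_cat yb.
  exists b2; split; rewrite //= ?zb2 //; first by apply: contraL zb => /hb.
  by move=> y yb; apply: fI; move: yb; rewrite !inE mem_cat => /orP[->|->];
    rewrite ?orbT.
have fI := fan_interval fa.
pose P := [set y in z :: a1 ++ a2].
have [hit|/hasPn nohit] := boolP (has (mem P) (z' :: b)); last first.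
  have /and5P[pa1 _ a1S _ ua] := fa.
  have sa1 : {subset z :: a1 <= z :: a1 ++ a2}.
    by move=> y; rewrite -cat_cons mem_cat => ->.
  exists a1, b; split; rewrite ?pa1 //.
    rewrite cat_uniq ub andbT; apply/andP; split.
      by move: ua; rewrite -cat_cons cat_uniq => /andP[].
    by apply/hasPn => y /nohit /=; rewrite inE; apply: contra => /sa1.
  by move=> y; rewrite mem_cat => /orP[/sa1/fI|/bI].
have [q [z'q qP sq /(_ ub) uq aq]] := first_hit z'b hit.
have zq : last z' q != z.
  by apply: contraTneq (mem_last z' q) => ->; apply: contra zb => /sq;
    rewrite inE (negPf zz').
wlog qa1 : a1 a2 fa fI @P {hit} qP aq / last z' q \in a1.
  move=> W; move: (qP); rewrite !inE (negPf zq) mem_cat /= => /orP[qa|qa].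
    exact: (W a1 a2).
  have sC : z :: a2 ++ a1 =i z :: a1 ++ a2.
    by move=> y; rewrite !inE !mem_cat (orbC (y \in a2)).
  apply: (W a2 a1); rewrite // 1?fanC //.
  - by move=> y; rewrite sC; apply: fI.
  - by move: qP; rewrite !(in_set, inE) !mem_cat (orbC (_ \in a1)).
  - by apply/allP => y /(allP aq) /=; rewrite !inE !mem_cat (orbC (y \in a1)).
have /and5P[pa1 pa2 a1S a2S ua] := fa.
case/splitPr: qa1 fI ua @P qP aq a1S pa1 {fa} => r1 r2 fI ua P qP aq a1S pa1.
move: pa1; rewrite cat_path /= => /and3P[_ _ pr2].
move: a1S; rewrite last_cat /= => r2S.
(* [z] leaves by [a2], while [z'] continues past the hit along [r2], the tail of [a1]. *)
exists a2, (q ++ r2); split; rewrite ?pa2 ?cat_path ?z'q ?last_cat //.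
  have pE : perm_eq ((z :: a2) ++ z' :: q ++ r2)
                    (belast z' q ++ (last z' q :: r2) ++ (z :: a2)).
    by rewrite -(cat_cons z') (lastI z') -cats1 -!catA perm_catC -!catA.
  apply: etrans (perm_uniq pE) _; rewrite cat_uniq; apply/and3P; split.
  - by move: uq; rewrite lastI rcons_uniq => /andP[].
  - apply/hasPn => y yr; apply/negP => /(allP aq) /=; rewrite inE /= => /negP;
    apply.
    by move: yr; rewrite !(mem_cat, inE) => /orP[/orP[]|/orP[]] ->;
      rewrite ?orbT.
  - apply: subseq_uniq (_ : subseq _ ((r1 ++ last z' q :: r2) ++ z :: a2)) _.
      by rewrite -catA suffix_subseq.
    by rewrite (perm_uniq (s2 := z :: (r1 ++ last z' q :: r2) ++ a2)) //
      -(cat1s z a2) perm_catCA.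
move=> y; rewrite -cat_cons mem_cat -(cat_cons z') mem_cat =>
  /orP[ya|/orP[/sq/bI //|yr]]; apply: fI.
  by move: ya; rewrite !inE mem_cat => /orP[]->; rewrite ?orbT.
by rewrite !(inE, mem_cat) yr !orbT.
Qed.

(** * Interval sets in a connected graph *)

Hypothesis e_conn : connected_on [set: T] e.

Lemma closed_setT A x :
  x \in A -> (forall u v, u \in A -> e u v -> v \in A) -> A = [set: T].
Proof.
move=> xA clA; apply/setP => y; rewrite inE.
have xy := connected_onP _ _ e_conn x y (in_setT x) (in_setT y).
by apply: closed_connect xy xA => u v uA /and3P[_ _]; apply: clA.
Qed.

(* The case [k = 2] of Menger's fan lemma, at all vertices at once: an edge
   leaving [I S] starts an ear on [I S], along which [I S] can be extended. *)
Lemma unseparated_interval_set S :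
  S != set0 ->
  (forall v w, v != w ->
     exists2 s, s \in S :\ w & connect (restr [set~ w] e) v s) ->
  interval_set e S.
Proof.
move=> /set0Pn[s0 s0S] unsep; apply/eqP; have sSI := subsetP (sub_interval S).
apply: (closed_setT (sSI _ s0S)) => u v uI uv; apply: contraT => vI.
have vu : v != u by apply: contraNneq vI => ->.
(* Avoiding [u] makes the ear return to [I S] at a vertex other than [u]. *)
have [s /setD1P[su sS] vs] := unsep v u vu.
have vNu : v \in [set~ u] by rewrite !inE.
have [p [vp ps up pNu]] := connect_restrP vNu vs.
have hit : has (mem (I S)) (v :: p).
  by apply/hasP; exists s; [rewrite -ps mem_last | apply: sSI].
have [q [vq qI sq /(_ up) uq aq]] := first_hit vp hit.
have qu : u != last v q.
  by have := pNu _ (sq _ (mem_last v q)); rewrite !inE eq_sym.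
have [p1 [p2 [/andP[up1 qp2] p1S p2S u12 s12]]] :=
  interval_disjoint_paths uI qI qu.
(* One path of the fan goes through [u] and [p1], the other along the ear [q] and then [p2]. The ear
   avoids [I S] before its end, while [p1] and [p2] stay inside. *)
suff fv : fan S v (u :: p1) (q ++ p2).
  by have := fan_interval fv (mem_head _ _); rewrite (negPf vI).
apply/and5P; split; rewrite ?cat_path ?last_cat //=.
- by rewrite e_sym uv.
- by rewrite vq.
apply: etrans (perm_uniq (_ : perm_eq ([:: v] ++ (u :: p1) ++ q ++ p2)
                 (belast v q ++ (u :: p1) ++ last v q :: p2))) _.
  rewrite perm_catCA (catA [:: v]) (lastI v q : [:: v] ++ q = _) -cats1.
  by rewrite -catA perm_catCA.
rewrite cat_uniq u12 andbT; apply/andP; split.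
  by move: uq; rewrite lastI rcons_uniq => /andP[].
by apply/hasPn => y /s12 yI; apply/negP => /(allP aq) /=; rewrite yI.
Qed.

(** With at most one vertex in [S], no path has distinct endpoints in [S], so [I S] is [S]
    itself. *)
Lemma interval_set_gt1 S : 1 < #|T| -> interval_set e S -> 1 < #|S|.
Proof.
move=> T1 /eqP IS; rewrite ltnNge; apply/negP => S1.
have : S = [set: T].
  apply/eqP; rewrite -subTset -IS subUset subxx; apply/subsetP => v.
  rewrite inE => /exists_inP[x xS /exists_inP[y yS /andP[/eqP[]]]].
  exact: (card_le1_eqP S1).
by move=> SE; move: S1; rewrite SE cardsT leqNgt T1.
Qed.

(** * Branches and lobes *)

(* A branch at [c] is the vertex set of a component of [G - c]. *)
Definition branch c C :=
  [&& C != set0, c \notin C, connected_on C e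
    & [forall x in C, forall y, e x y ==> (y \in C) || (y == c)]].

Lemma branchP c C :
  reflect [/\ C != set0, c \notin C, connected_on C e
            & forall x y, x \in C -> e x y -> y \notin C -> y = c]
          (branch c C).
Proof.
apply: (iffP and4P) => -[C0 cC Cc Ce]; split=> //.
  move=> x y xC xy yC; have /forallP/(_ y) := forall_inP Ce x xC.
  by rewrite xy (negPf yC) => /eqP.
apply/forall_inP => x xC; apply/forallP => y; apply/implyP => xy.
by have [//|yC] := boolP (y \in C); rewrite (Ce x y xC xy yC) eqxx.
Qed.

Lemma component_branch c x :
  x != c -> branch c [set y | connect (restr [set~ c] e) x y].
Proof.
move=> xc; have xN : x \in [set~ c] by rewrite !inE.
set C := [set y | _]; have xC : x \in C by rewrite inE.
have cC : c \notin C.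
  by apply/negP; rewrite inE => /connect_restr_mem /(_ xN); rewrite !inE eqxx.
have rS := sym_connect_sym (restr_sym [set~ c] e_sym).
apply/branchP; split=> //; first by apply/set0Pn; exists x.
  apply/connected_onP => u v uC vC.
  apply: (connect_restrS (A := C) (r := restr [set~ c] e)) => //.
    by move=> ? ? _ _ /and3P[].
  apply: connect_restr_closed => //.
    by move=> a b; rewrite !inE => xa ab; apply: connect_trans xa (connect1 ab).
  by move: uC vC; rewrite !inE rS; apply: connect_trans.
move=> u v uC uv; apply: contraNeq => vc; move: (uC); rewrite !inE => xu.
apply: connect_trans xu (connect1 _); rewrite /restr /= uv !inE vc !andbT.
by apply: contraTneq uC => ->.
Qed.

(** If every component of [G - c] contained [w], there would be only one. *)
Lemma cut_vertex_branch c w :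
  cut_vertex e c -> exists2 D, branch c D & w \notin D.
Proof.
move=> /connected_onP cutc.
have [/existsP[D /andP[]]|/existsPn noD] :=
  boolP [exists D, branch c D && (w \notin D)]; first by exists D.
case: cutc => x y; rewrite !inE => xc yc.
have wD z : z != c -> connect (restr [set~ c] e) z w.
  by move=> zc; have := noD [set y | connect (restr [set~ c] e) z y];
     rewrite component_branch //= negbK inE.
have rS := sym_connect_sym (restr_sym [set~ c] e_sym).
by apply: connect_trans (wD x xc) _; rewrite rS wD.
Qed.

(** Edges leave [D] only to [w], so no edge leaves the union of [D] and what [w] reaches outside
    [D]. *)
Lemma branch_compl_connect w D y :
  branch w D -> y \notin D -> connect (restr (~: D) e) w y.
Proof.
case/branchP=> _ wD _ De yD.
pose Z := [set z | connect (restr (~: D) e) w z].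
suff ZT : Z :|: D = [set: T].
  by move/setP: ZT => /(_ y); rewrite !inE (negPf yD) orbF.
apply: (@closed_setT _ w) => [|u v]; first by rewrite !inE connect0.
rewrite !inE; have [vD|vD] := boolP (v \in D); first by rewrite orbT.
rewrite orbF => /orP[wu uv|uD uv]; last by rewrite (De u v).
apply: connect_trans (wu) (connect1 _); rewrite /restr /= uv !inE vD !andbT.
by have := connect_restr_mem wu; rewrite !inE; apply.
Qed.

Definition lobe (l : T * {set T}) :=
  [&& cut_vertex e l.1, branch l.1 l.2 & [forall x in l.2, ~~ cut_vertex e x]].

(** Induction on the size: a cut vertex [u] in [D] has a branch that avoids [w], and this branch
    lies in [D] without containing [u]. *)
Lemma branch_lobe w D :
  cut_vertex e w -> branch w D -> exists2 l, lobe l & l.2 \subset D.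
Proof.
have [n] := ubnP #|D|; elim: n w D => // n IH w D /ltnSE Dn cutw bD.
have [noc|] := boolP [forall x in D, ~~ cut_vertex e x].
  by exists (w, D); rewrite /lobe /= ?cutw ?bD.
case/forall_inPn=> u uD; rewrite negbK => cutu.
have [D' bD' wD'] := cut_vertex_branch w cutu.
have /branchP[_ uD' _ De'] := bD'.
(* Everything outside [D] reaches [w] without passing [u], so a branch at [u] with a vertex there
   would contain [w]. *)
have sD'D : D' \subset D.
  apply/subsetP => y yD'; apply: contraT => yD.
  have yw := branch_compl_connect bD yD.
  rewrite (sym_connect_sym (restr_sym (~: D) e_sym)) in yw.
  case/negP: wD'; apply: closed_connect yw yD' => a b aD' /and3P[_ bND ab].
  apply: contraT => bND'; move: bND; rewrite inE.
  by rewrite (De' a b) // uD.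
have [|l lobel sl] := IH u D' _ cutu bD'; first last.
  by exists l; rewrite ?(subset_trans sl).
apply: leq_trans Dn; apply: proper_card; apply/properP; split=> //.
by exists u.
Qed.

(** A lobe contains no cut vertex, so it cannot leave another lobe that it meets; hence the sets
    agree. With two different cut vertices, no edge could leave the common set. *)
Lemma lobe_disjoint l l' x :
  lobe l -> lobe l' -> x \in l.2 -> x \in l'.2 -> l = l'.
Proof.
have sub m m' : lobe m -> lobe m' -> x \in m.2 -> x \in m'.2 -> m.2 \subset
  m'.2.
  case/and3P=> _ /branchP[_ _ mc _] /forall_inP mN.
  case/and3P=> m'cut /branchP[_ _ _ m'e] _ xm xm'.
  apply/subsetP => y ym; have xy := connected_onP _ _ mc x y xm ym.
  apply: closed_connect xy xm' => a b am' /and3P[_ bm ab].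
  apply: contraT => bm'; have := mN b bm.
  by rewrite (m'e a b) // m'cut.
move=> ll ll' xl xl'.
have E : l.2 = l'.2 by apply/eqP; rewrite eqEsubset !sub.
case: l l' ll ll' E xl {xl' sub} => [c C] [c' C'] /= ll ll' E xC.
rewrite -{}E in ll' *; congr (_, _).
have /and3P[_ /branchP[_ cC _ Ce] _] := ll.
have /and3P[_ /branchP[_ _ _ Ce'] _] := ll'.
apply/eqP; apply: contraT => cc'.
suff CT : C = [set: T] by rewrite /= CT inE in cC.
apply: (closed_setT xC) => u v uC uv; apply: contraT => vC.
by move: cc'; rewrite -[c](Ce u v) // -[c'](Ce' u v) // eqxx.
Qed.

Definition lobes := [set l | lobe l].

(** Serves both bounds on the interval number: with [S] the whole vertex set it supplies an interval
    set, with [S] a minimum interval set it bounds the number of lobes. *)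
Lemma lobe_transversal S :
  (forall l, lobe l -> S :&: l.2 != set0) ->
  exists S0, [/\ S0 \subset S, #|S0| = #|lobes|
               & forall l, lobe l -> S0 :&: l.2 != set0].
Proof.
(* The default [l.1] is never taken on a lobe, as [S] meets every lobe. *)
move=> meet; pose f (l : T * {set T}) := odflt l.1 [pick x in S :&: l.2].
have fP l : lobe l -> f l \in S :&: l.2.
  move=> /meet/set0Pn[x xS]; rewrite /f.
  by case: pickP => [//|/(_ x)]; rewrite xS.
exists (f @: lobes); split.
- apply/subsetP => _ /imsetP[l lL ->]; rewrite inE in lL.
  by have /setIP[] := fP l lL.
- apply: card_in_imset => l l'; rewrite !inE => ll ll' E.
  have /setIP[_ fl] := fP l ll; have /setIP[_ fl'] := fP l' ll'.
  by apply: (lobe_disjoint (x := f l)); rewrite // E.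
- move=> l ll; apply/set0Pn; exists (f l); have /setIP[_ fl] := fP l ll.
  by rewrite inE fl andbT imset_f // inE.
Qed.

Lemma branch_exit c C v p :
  branch c C -> path e v p -> v \in C -> last v p \notin C -> c \in p.
Proof.
case/branchP=> _ _ _ Ce; elim: p v => [|y p IH] v /=.
  by move=> _ ->.
case/andP=> vy yp vC pC; have [yC|yC] := boolP (y \in C).
  by rewrite inE (IH y) ?orbT.
by rewrite (Ce v y) // mem_head.
Qed.

(** If [S] missed [C], both paths of a fan at a vertex of [C] would pass through [c], though they
    share only their start. *)
Lemma interval_set_meets_branch S c C :
  interval_set e S -> branch c C -> S :&: C != set0.
Proof.
move=> /eqP IS bC; have /branchP[/set0Pn[v vC] _ _ _] := bC.
have : v \in I S by rewrite /I IS inE.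
case/interval_fan=> p1 [p2 /and5P[vp1 vp2 p1S p2S up]].
apply: contraTneq up => SC0.
have out x : x \in S -> x \notin C.
  by move=> xS; apply/negP => xC; move/setP: SC0 => /(_ x); rewrite !inE xS xC.
have c1 := branch_exit bC vp1 vC (out _ p1S).
have c2 := branch_exit bC vp2 vC (out _ p2S).
rewrite /= cat_uniq negb_and; apply/orP; right; rewrite negb_and negb_and negbK.
by apply/orP; right; apply/orP; left; apply/hasP; exists c.
Qed.

Lemma interval_number_lobes c : cut_vertex e c -> interval_number e = #|lobes|.
Proof.
move=> cutc; have [[S IS SE] minS] := interval_numberP e.
apply/eqP; rewrite eqn_leq; apply/andP; split.
  have [|S0 [_ <- meet]] := @lobe_transversal [set: T].
    by move=> l /and3P[_ /branchP[l0 _ _ _] _]; rewrite setTI.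
  have meetD w D : cut_vertex e w -> branch w D -> exists2 s, s \in S0 & s \in
    D.
    move=> cutw bD; have [l ll /subsetP slD] := branch_lobe cutw bD.
    by have /set0Pn[s /setIP[sS /slD sD]] := meet l ll; exists s.
  have avoid w : exists2 s, s \in S0 & s != w.
    have [D bD wD] := cut_vertex_branch w cutc.
    have [s sS sD] := meetD c D cutc bD.
    by exists s => //; apply: contraNneq wD => <-.
  apply: minS; apply: unseparated_interval_set.
    by have [s sS _] := avoid c; apply/set0Pn; exists s.
  (* If [w] is a cut vertex, [S0] meets the component of [v] in [G - w]; otherwise [G - w] is
     connected and any member of [S0] other than [w] serves. *)
  move=> v w vw; have [cutw|] := boolP (cut_vertex e w).
    have bD := component_branch vw; have [s sS sD] := meetD w _ cutw bD.
    rewrite inE in sD; exists s => //; rewrite !inE sS andbT.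
    by have := connect_restr_mem sD; rewrite !inE; apply.
  rewrite negbK => /connected_onP cw; have [s sS sw] := avoid w.
  by exists s; rewrite ?cw ?inE ?sw.
have [l ll|S0 [sS <- _]] := @lobe_transversal S.
  by case/and3P: ll => _ bl _; apply: interval_set_meets_branch bl.
by rewrite -SE subset_leq_card.
Qed.

(** Any two vertices form an interval set: deleting [w] leaves at least one of them, in a connected
    graph. *)
Lemma interval_number_two_connected :
  two_connected_on [set: T] e -> interval_number e = 2.
Proof.
case/and3P=> T2 _ /forall_inP cw; rewrite cardsT in T2.
have [[S IS SE] minS] := interval_numberP e.
apply/eqP; rewrite eqn_leq; apply/andP; split; last first.
  by rewrite -SE interval_set_gt1 // ltnW.
have /card_gt1P[x [y [_ _ xy]]] : 1 < #|[set: T]| by rewrite cardsT ltnW.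
apply: (@leq_trans #|[set x; y]|); last by rewrite cards2 xy.
apply: minS; apply: unseparated_interval_set.
  by apply/set0Pn; exists x; rewrite !inE eqxx.
move=> v w vw; have /connected_onP := cw w (in_setT w); rewrite setTD => cw'.
have [s sS] : exists s, s \in [set x; y] :\ w.
  by have [<-|xw] := eqVneq x w; [exists y | exists x];
     rewrite !inE ?xw ?eqxx ?orbT // eq_sym xy.
by exists s => //; rewrite cw' // !inE //; case/setD1P: sS.
Qed.

(** * Two-connected vertex sets *)

Lemma connected_onS A (r r' : rel T) :
  {in A &, subrel r r'} -> connected_on A r -> connected_on A r'.
Proof.
move=> srr /connected_onP cA; apply/connected_onP => x y xA yA.
exact: connect_restrS (subxx A) srr (cA x y xA yA).
Qed.

(** Two vertices of [A] are joined within [A] minus some third vertex. *)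
Lemma two_connected_onI A (r : rel T) :
  2 < #|A| -> {in A, forall v, connected_on (A :\ v) r} -> two_connected_on A r.
Proof.
move=> A2 cA; apply/and3P; split=> //; last exact/forall_inP.
apply/connected_onP => x y xA yA.
have /subsetPn[w wA] : ~~ (A \subset [set x; y]).
  apply: contraL A2 => /subset_leq_card sA; rewrite -leqNgt.
  by apply: leq_trans sA _; rewrite cards2; case: (x != y).
rewrite !inE negb_or => /andP[wx wy].
apply: (connect_restrS (subsetDl A [set w]) (r := r)) => //.
by apply: (connected_onP _ _ (cA w wA)); rewrite !inE 1?eq_sym ?wx ?wy.
Qed.

Lemma two_connected_onS A (r r' : rel T) :
  {in A &, subrel r r'} -> two_connected_on A r -> two_connected_on A r'.
Proof.
move=> srr /and3P[A2 _ /forall_inP cA].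
apply: two_connected_onI => // v vA; apply: connected_onS (cA v vA).
by move=> x y /setD1P[_ xA] /setD1P[_ yA]; apply: srr.
Qed.

Lemma two_connected_onD1 A (r : rel T) w :
  two_connected_on A r -> connected_on (A :\ w) r.
Proof.
case/and3P=> _ cA /forall_inP cAv; have [wA|wA] := boolP (w \in A).
  exact: cAv.
by have /setDidPl -> : [disjoint A & [set w]] by rewrite disjoint_sym
  disjoints1.
Qed.

(* A path of [G - w] between two vertices of [A] stays in [A]: a vertex [v] that
   separated one of its vertices from [B] would lie on it on both sides. *)
Lemma unseparated_two_connected B :
  two_connected_on B e ->
  let A := [set x | [forall w, (w != x) ==>
              [exists h in B :\ w, connect (restr [set~ w] e) x h]]] in
  (B \subset A) /\ two_connected_on A e.
Proof.
move=> cB A; have AP x w : x \in A -> w != x ->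
    exists2 h, h \in B :\ w & connect (restr [set~ w] e) x h.
  by rewrite inE => /forallP/(_ w)/implyP xA /xA/exists_inP.
have sBA : B \subset A.
  apply/subsetP => x xB; rewrite inE; apply/forallP => w; apply/implyP => wx.
  by apply/exists_inP; exists x; rewrite ?connect0 // !inE eq_sym wx.
split=> //; apply: two_connected_onI => [|w _].
  by case/and3P: cB => B2 _ _; apply: leq_trans B2 (subset_leq_card sBA).
have cS v := sym_connect_sym (restr_sym [set~ v] e_sym).
apply/connected_onP => x y /setD1P[xw xA] /setD1P[yw yA].
have xy : connect (restr [set~ w] e) x y.
  have [h hB xh] : exists2 h, h \in B :\ w & connect (restr [set~ w] e) x h.
    by apply: AP; rewrite // eq_sym.
  have [k kB yk] : exists2 h, h \in B :\ w & connect (restr [set~ w] e) y h.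
    by apply: AP; rewrite // eq_sym.
  apply: connect_trans xh _; rewrite cS; apply: connect_trans yk _.
  have := connected_onP _ _ (two_connected_onD1 w cB) k h kB hB.
  by apply: connect_restrS => //; apply/subsetP => z; rewrite !inE => /andP[].
have xN : x \in [set~ w] by rewrite !inE.
have [p [xp py up sp]] := connect_restrP xN xy.
rewrite -py; apply: connect_restr_path => // q qp.
have := sp q qp; rewrite !inE => -> /=.
apply/forallP => v; apply/implyP => vq; apply/exists_inP.
case/splitPl: qp xp py up {sp} => p1 p2 p1q.
rewrite cat_path last_cat p1q -cat_cons => /andP[xp1 qp2] p2y up.
(* The path is simple, so [v] misses one of its two halves at [q]; that half leads to an end of the
   path, which [v] does not separate from [B]. *)
have [vp1|vp1] := boolP (v \in x :: p1).
  have vp2 : v \notin q :: p2.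
    move: up; rewrite cat_uniq inE negb_or vq => /and3P[_ /hasPn h _].
    by apply: contraL vp1 => /h.
  have vy : v != y by apply: contraNneq vp2 => ->; rewrite -p2y mem_last.
  have [h hB yh] := AP y v yA vy; exists h => //; apply: connect_trans yh.
  rewrite -p2y; apply: connect_restr_path => // z zp; rewrite !inE.
  by apply: contraNneq vp2 => <-.
have vx : v != x by apply: contraNneq vp1 => ->; rewrite mem_head.
have [h hB xh] := AP x v xA vx; exists h => //; apply: connect_trans xh.
rewrite cS -p1q; apply: connect_restr_path => // z zp; rewrite !inE.
by apply: contraNneq vp1 => <-.
Qed.

(** * Induced subgraphs as blocks *)

Definition induced A : subgraph T :=
  (A, [set a | [exists x in A, exists y in A, e x y && (a == [set x; y])]]).

Lemma set2_inj x y x' y' :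
  [set x; y] = [set x'; y'] -> (x = x' /\ y = y') \/ (x = y' /\ y = x').
Proof.
move/setP=> E; move: (E x) (E y) (E x') (E y'); rewrite !inE !eqxx ?orbT /=.
move=> /esym/orP[]/eqP-> /esym/orP[]/eqP->; rewrite ?orbb;
  by [left | right | move=> _ /eqP->; left | move=> /eqP-> _; left].
Qed.

Lemma subgraph_edge (H : subgraph T) x y :
  is_subgraph e H -> [set x; y] \in H.2 -> [/\ x \in H.1, y \in H.1 & e x y].
Proof.
move=> /forall_inP sH /sH /exists_inP[u uH /exists_inP[v vH /andP[uv /eqP]]].
by case/set2_inj=> -[-> ->]; rewrite // e_sym.
Qed.

Lemma is_subgraph_induced A : is_subgraph e (induced A).
Proof. by apply/forall_inP => a; rewrite inE. Qed.

Lemma induced_edge A x y :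
  x \in A -> y \in A -> e x y -> [set x; y] \in (induced A).2.
Proof.
move=> xA yA xy; rewrite inE; apply/exists_inP; exists x => //.
by apply/exists_inP; exists y; rewrite // xy eqxx.
Qed.

Lemma subgraph_le_induced (H : subgraph T) A :
  is_subgraph e H -> H.1 \subset A -> subgraph_le H (induced A).
Proof.
move=> /forall_inP sH sHA; rewrite /subgraph_le sHA; apply/subsetP => a /sH.
case/exists_inP=> u uH /exists_inP[v vH /andP[uv /eqP->]].
by apply: induced_edge; rewrite // (subsetP sHA).
Qed.

Lemma two_connected_induced A :
  two_connected_on A e -> two_connected_subgraph e (induced A).
Proof.
move=> cA; rewrite /two_connected_subgraph is_subgraph_induced /=.
by apply: two_connected_onS cA => x y xA yA xy; apply: induced_edge.
Qed.

Lemma two_connected_subgraph_on (H : subgraph T) :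
  two_connected_subgraph e H -> two_connected_on H.1 e.
Proof.
case/andP=> sH; apply: two_connected_onS => x y _ _ /=.
by case/(subgraph_edge sH).
Qed.

Lemma edge_subgraph_induced x y :
  e x y -> edge_subgraph x y = induced [set x; y].
Proof.
move=> xy; congr (_, _); apply/setP => a; rewrite in_set1.
apply/eqP/idP => [->|]; first by apply: induced_edge; rewrite ?set21 ?set22.
rewrite inE => /exists_inP[u + /exists_inP[v + /andP[uv /eqP->]]].
rewrite !inE => /orP[]/eqP uE /orP[]/eqP vE; rewrite uE vE in uv *;
  rewrite ?e_irr // in uv.
by rewrite setUC.
Qed.

(** Deleting [c] leaves the branch. For [v] in [C], [G - v] is connected, and a walk in it leaves
    and re-enters [c |: C] only through [c], so detours can be cut out. *)
Lemma branch_two_connected c C :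
  branch c C -> 1 < #|C| -> {in C, forall x, ~~ cut_vertex e x} ->
  two_connected_on (c |: C) e.
Proof.
case/branchP=> _ cC Cc Ce C1 noc; apply: two_connected_onI => [|v].
  by rewrite cardsU1 cC.
rewrite !inE => /predU1P[->|vC]; first by rewrite setU1K.
have cv : c != v by apply: contraNneq cC => ->.
have /negPn/connected_onP cNv := noc v vC.
pose Z := [set z | connect (restr ((c |: C) :\ v) e) c z].
suff toc x : x \in (c |: C) :\ v -> x \in Z.
  apply/connected_onP => x y /toc; rewrite inE => cx /toc; rewrite inE.
  by apply: connect_trans; rewrite (sym_connect_sym (restr_sym _ e_sym)).
case/setD1P=> xv xA.
(* With the outside added, [Z] is closed under the edges of [G - v]: from outside one enters only at
   [c], which is in [Z]. *)
suff : x \in Z :|: ~: (c |: C) by rewrite inE [in X in _ || X]inE xA orbF.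
have cx : connect (restr [set~ v] e) c x by rewrite cNv // !inE.
apply: closed_connect cx _ => [a b|]; last by rewrite !inE connect0.
have [bA|bA] := boolP (b \in c |: C); last first.
  by move=> _ _; rewrite inE [in X in _ || X]inE bA orbT.
move=> aW /and3P[_ bv ab]; rewrite inE in_set; apply/orP; left.
rewrite !inE in bv; move: aW; rewrite inE => /orP[|].
  rewrite inE => ca; apply: connect_trans (ca) (connect1 _).
  apply/and3P; split=> //; last by rewrite in_setD1 bv.
  by apply: connect_restr_mem ca _; rewrite !inE cv eqxx.
rewrite !inE negb_or => /andP[ac aC]; move: bA; rewrite !inE.
case/predU1P=> [->|bC]; first exact: connect0.
by move: ac; rewrite (Ce b a) // ?eqxx // e_sym.
Qed.

(** [K - c] is connected and meets [C], and edges leave [C] only to [c]; so [K] has no further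
    vertices, and the induced subgraph already has all edges. *)
Lemma branch_maximal c C (K : subgraph T) :
  branch c C -> two_connected_subgraph e K ->
  subgraph_le (induced (c |: C)) K -> K = induced (c |: C).
Proof.
case/branchP=> /set0Pn[x xC] cC _ Ce cK /andP[/= sAK s2K].
have CK y : y \in C -> y \in K.1 by move=> yC; apply: (subsetP sAK);
  rewrite !inE yC orbT.
have sKA : K.1 \subset c |: C.
  apply/subsetP => y yK; rewrite !inE; have [//|yc] := eqVneq y c.
  have cKc := two_connected_onD1 c (two_connected_subgraph_on cK).
  have xc : x != c by apply: contraNneq cC => <-.
  have xy : connect (restr (K.1 :\ c) e) x y.
    by apply: (connected_onP _ _ cKc); rewrite !inE ?xc ?yc ?yK ?CK.
  apply: closed_connect xy xC => a b aC /and3P[_ /setD1P[bc _] ab].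
  by apply: contraNT bc => bC; rewrite (Ce a b).
have /andP[sK _] := cK; have /andP[_ s2] := subgraph_le_induced sK sKA.
case: K {CK cK sK} sAK s2K sKA s2 => K1 K2 /= sAK s2K sKA s2.
by congr (_, _); apply/eqP; rewrite eqEsubset ?sKA ?sAK ?s2K ?s2.
Qed.

(** By connectedness [x] has an edge, which can only go to [c]; removing it isolates [x]. *)
Lemma branch_leaf_cut_edge c x : branch c [set x] -> cut_edge e x c.
Proof.
case/branchP=> _ cx _ xe; rewrite inE in cx.
have xc : e x c.
  apply: contraT => xNc; suff xT : [set x] = [set: T].
    by have := in_setT c; rewrite -xT inE (negPf cx).
  apply: (closed_setT (set11 x)) => u v; rewrite !inE => /eqP-> xv.
  apply: contraT => vx; case/negP: xNc; rewrite -(xe x v) ?inE ?eqxx //.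
rewrite /cut_edge xc; apply/negP => /connected_onP cT.
have {cT} xc' := cT x c (in_setT x) (in_setT c).
suff : c \in [set x] by rewrite inE (negPf cx).
apply: closed_connect xc' (set11 x) => u v.
rewrite !inE => /eqP-> /and3P[_ _ /andP[xv]].
by apply: contraNT => vx; rewrite (xe x v) ?inE.
Qed.

(** * End blocks and lobes *)

Lemma end_blockP (H : subgraph T) :
  reflect (block e H /\ exists c, forall v, cut_vertex e v && (v \in H.1) = (v
    == c))
          (bct_leaf e (inl H)).
Proof.
apply: (iffP andP) => -[bH]; last first.
  case=> c cP; split=> //; apply/cards1P; exists (inr c).
  (* A block is adjacent only to cut vertices, so only the nodes [inr v] count. *)
  by apply/setP => -[K|v]; rewrite !inE ?andbF //=.
case/cards1P=> m /setP mP; split=> //; have := mP m; rewrite !inE eqxx.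
case: m mP => [K|c] mP; first by rewrite andbF.
by move=> _; exists c => v; have := mP (inr v); rewrite !inE.
Qed.

(** A lobe with one vertex gives a cut edge, a larger one a maximal 2-connected subgraph. *)
Lemma lobe_end_block l :
  lobe l -> bct_leaf e (inl (induced (l.1 |: l.2))).
Proof.
case: l => c C /and3P[/= cutc bC /forall_inP noc]; apply/end_blockP; split;
  last first.
  exists c => v; rewrite !inE; have [->|vc] := eqVneq v c;
    first by rewrite cutc.
  by apply/negP => /andP[cutv /= /noc]; rewrite cutv.
have /branchP[C0 _ _ _] := bC; have [C1|C1] := ltnP 1 #|C|; apply/orP.
  right; rewrite /maximal_two_connected two_connected_induced /=; last first.
    exact: branch_two_connected.
  by apply/forallP => K; apply/implyP => /andP[cK sK]; apply/eqP;
    apply: branch_maximal.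
left; have /cards1P[x Cx] : #|C| == 1 by rewrite eqn_leq C1 card_gt0.
rewrite Cx in bC *; have xc := branch_leaf_cut_edge bC.
apply/existsP; exists x; apply/existsP; exists c; rewrite xc /=.
by case/andP: xc => xc _; rewrite edge_subgraph_induced // setUC.
Qed.

Lemma cut_edgeC x y : cut_edge e x y = cut_edge e y x.
Proof. by rewrite /cut_edge e_sym (setUC [set x]). Qed.

Lemma edge_subgraphC x y : edge_subgraph x y = edge_subgraph y x.
Proof. by rewrite /edge_subgraph (setUC [set x]). Qed.

(** If [x] had a neighbour [t] other than [y], then [G - x], being connected, would link [t] to [y]
    and so bypass the edge. *)
Lemma cut_edge_branch x y :
  cut_edge e x y -> ~~ cut_vertex e x -> branch y [set x].
Proof.
case/andP=> xy cutxy /negPn/connected_onP cx.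
have yx : y != x by apply: contraTneq xy => ->; rewrite e_irr.
apply/branchP; split; rewrite ?inE //.
- by apply/set0Pn; exists x; rewrite inE.
- by apply/connected_onP => u v; rewrite !inE => /eqP-> /eqP->.
move=> u t; rewrite !inE => /eqP-> xt tx; apply: contraNeq cutxy => ty.
set r := [rel u v | _]; have rS : symmetric (restr [set: T] r).
  by apply: restr_sym => a b; rewrite /r /= e_sym (setUC [set a]).
have rxy : connect (restr [set: T] r) x y.
  apply: (@connect_trans _ _ t).
    apply: connect1; rewrite /restr /= !inE xt /=.
    by apply: contraNneq ty => /set2_inj[[_ ->]|[xy' tx']] //; rewrite tx' xy'.
  have : connect (restr [set~ x] e) t y by rewrite cx ?inE.
  apply: connect_sub => a b /and3P[ax bx ab]; apply: connect1.
  rewrite !inE in ax bx; rewrite /restr /= !inE ab /=.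
  by apply: contraNneq ax => /set2_inj[[-> _]|[_ bx']] //;
    rewrite bx' eqxx in bx.
apply/connected_onP => a b aT bT.
apply: connect_sub (connected_onP _ _ e_conn a b aT bT) => u' v' /and3P[_ _ uv].
have [/set2_inj[[-> ->]|[-> ->]]|ne] := eqVneq [set u'; v'] [set x; y] => //.
  by rewrite (sym_connect_sym rS).
by apply: connect1; rewrite /restr /= !inE uv.
Qed.

Lemma end_block_lobe (H : subgraph T) :
  bct_leaf e (inl H) -> exists2 l, lobe l & H = induced (l.1 |: l.2).
Proof.
case/end_blockP=> bH [c cP]; have := cP c; rewrite eqxx => /andP[cutc cH].
have noc x : x \in H.1 -> x != c -> ~~ cut_vertex e x.
  by move=> xH xc; have := cP x; rewrite xH andbT (negPf xc) => ->.
case/orP: bH => [/existsP[x /existsP[y /andP[xy /eqP HE]]]|/andP[cH2 /forallP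
  maxH]].
  wlog yc : x y xy HE / y = c.
    move=> W; move: (cH); rewrite {1}HE !inE => /orP[]/eqP/esym E;
      last exact: (W x y).
    by apply: (W y x); rewrite // 1?cut_edgeC // HE edge_subgraphC.
  have exy : e x y by case/andP: xy.
  have xc : x != c by apply: contraTneq exy => ->; rewrite yc e_irr.
  have nx : ~~ cut_vertex e x by apply: noc; rewrite // HE set21.
  exists (c, [set x]); last by rewrite HE edge_subgraph_induced // yc setUC.
  apply/and3P; split=> //; first by rewrite -yc /= cut_edge_branch.
  by apply/forall_inP => z; rewrite inE => /eqP->.
have cH1 := two_connected_subgraph_on cH2; have /andP[sH _] := cH2.
(* Maximality makes [H] the subgraph induced by [A], so a vertex that no other vertex separates from
   [H.1] belongs to [H.1]. *)
have [] := unseparated_two_connected cH1; set A := [set x | _] => sHA cA.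
have HE : induced A = H.
  by have := maxH (induced A);
    rewrite two_connected_induced //= subgraph_le_induced // => /eqP.
have AH : A = H.1 by rewrite -HE.
exists (c, H.1 :\ c); last by rewrite /= setD1K // -AH.
apply/and3P; split=> //=; last first.
  by apply/forall_inP => x /setD1P[xc xH]; apply: noc.
apply/branchP; split; rewrite ?setD11 ?two_connected_onD1 //.
  by rewrite -card_gt0; case/and3P: cH1; rewrite (cardsD1 c) cH; case: #|_|.
move=> x y /setD1P[xc xH] xy; apply: contraNeq => yc;
  rewrite in_setD1 yc /= -AH inE.
(* The neighbour [y] of [x] is in [A]: if [w] is not [x], it reaches [x] directly; if [w] is [x],
   which is no cut vertex, it reaches [c]. *)
apply/forallP => w; apply/implyP => wy; apply/exists_inP.
have [->|wx] := eqVneq w x; last first.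
  exists x; first by rewrite in_setD1 eq_sym wx.
  by apply: connect1; rewrite /restr /= e_sym xy !inE eq_sym wy eq_sym wx.
exists c; first by rewrite in_setD1 eq_sym xc.
have /negPn/connected_onP := noc x xH xc; apply; rewrite !inE;
  last by rewrite eq_sym.
by apply: contraTneq xy => ->; rewrite e_irr.
Qed.

(** The map from lobes to end blocks is injective: [c] is recovered as the only cut vertex in
    [c |: C], and [C] as the rest. *)
Lemma eb_lobes : eb e = #|lobes|.
Proof.
rewrite -(card_in_imset (f := fun l => induced (l.1 |: l.2)) (D := lobes)).
  congr #|pred_of_set _|; apply/setP => H; rewrite inE.
  apply/idP/imsetP => [/end_block_lobe[l ll ->]|[l + ->]].
    by exists l; rewrite // inE.
  by rewrite inE => /lobe_end_block.
move=> [c C] [c' C']; rewrite !inE => /and3P[/= cutc /branchP[_ cC _ _] _].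
case/and3P=> /= _ /branchP[_ cC' _ _] /forall_inP noc' [E _].
have cc' : c = c'.
  have : c \in c' |: C' by rewrite -E setU11.
  by rewrite !inE => /predU1P[//|/noc']; rewrite cutc.
by rewrite -(setU1K cC) E cc' setU1K.
Qed.

End Graph.

(** * The cases of the formula *)

Theorem theorem5 (T : finType) (e : rel T)
    (e_sym : symmetric e) (e_irr : irreflexive e)
    (T_nonempty : 0 < #|T|) (e_conn : connected_on [set: T] e) :
  interval_number e =
    if #|T| == 1 then 1
    else if (#|T| == 2) || two_connected_on [set: T] e then 2
    else eb e.
Proof.
have [[S IS SE] minS] := interval_numberP e.
have leT : interval_number e <= #|T|.
  by rewrite -cardsT; apply/minS/interval_setT.
case: eqP => [T1|/eqP T1].
  apply/eqP; rewrite eqn_leq -{1}T1 leT -SE card_gt0.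
  apply: contraTneq IS => ->; rewrite /interval_set eq_sym;
    apply/negP => /eqP/setP I0.
  have [x _] := card_gt0P T_nonempty; have := I0 x; rewrite !inE => /esym.
  by case/exists_inP=> y; rewrite inE.
have T2 : 1 < #|T| by rewrite ltn_neqAle eq_sym T1.
have [/eqP T2E|T3] := boolP (#|T| == 2); first rewrite /=.
  by apply/eqP; rewrite eqn_leq -{1}T2E leT -SE (interval_set_gt1 T2 IS).
case: ifP => [cT|ncT]; first exact: interval_number_two_connected.
(* With at least three vertices, only a cut vertex can keep the connected graph from being
   2-connected. *)
have [c cutc] : exists c, cut_vertex e c.
  apply/existsP; apply: contraFT ncT => /existsPn nc.
  apply: two_connected_onI => [|v _];
    first by rewrite cardsT ltn_neqAle eq_sym T3.
  by have /negPn := nc v; rewrite setTD.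
by rewrite (eb_lobes e_sym e_irr e_conn) (interval_number_lobes e_sym e_conn
  cutc).
Qed.
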